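(* Let $q,\beta>0$ and $n\in\mathbb{N}$. For every $f\in C_B(\mathbb{R})\cup C_U(\mathbb{R})$, $$\omega(B_n^*(f),\theta)\le\omega(f,\theta)\quad\text{for all }\theta>0.$$ Furthermore, if $f\in C_U(\mathbb{R})$ then $B_n^*(f)\in C_U(\mathbb{R})$.
   Context: $\mathbb{N}=\{1,2,\dots\}$. For $q,\beta>0$ and $x\in\mathbb{R}$ let $\nu_{q}(x)=\frac{1-qe^{-\beta x}}{1+qe^{-\beta x}}$ and $G_{q,\beta}(x)=\frac14\left(\nu_{q}(x+1)-\nu_{q}(x-1)\right)$; $G_{1/q,\beta}$ is the same with $q$ replaced by $1/q$. Let $\Psi=\frac12\left(G_{q,\beta}+G_{1/q,\beta}\right)$ (an even probability density on $\mathbb{R}$). $C_B(\mathbb{R})$ is the set of continuous bounded real functions on $\mathbb{R}$; $C_U(\mathbb{R})$ is the set of uniformly continuous (not necessarily bounded) real functions on $\mathbb{R}$. For $\theta>0$, $\omega(f,\theta)=\sup\{|f(x)-f(y)|: x,y\in\mathbb{R},\ |x-y|\le\theta\}$. The (Kantorovich type) operator $B_n^*$ is $$B_n^*(f)(x)=n\int_{-\infty}^{\infty}\left(\int_0^{1/n}f\left(h+\frac vn\right)dh\right)\Psi(nx-v)\,dv .$$ *)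

(* Defs.v *)
From HB Require Import structures.
From mathcomp Require Import all_boot all_order all_algebra.
From mathcomp Require Import all_classical all_reals all_analysis.
Set Implicit Arguments.
Unset Strict Implicit.
Unset Printing Implicit Defensive.
Import Order.TTheory GRing.Theory Num.Theory.
Import numFieldNormedType.Exports.
Local Open Scope classical_set_scope.
Local Open Scope ring_scope.

Definition nu (R : realType) (q beta x : R) : R :=
  (1 - q * expR (- beta * x)) / (1 + q * expR (- beta * x)).

Definition G (R : realType) (q beta x : R) : R :=
  4^-1 * (nu q beta (x + 1) - nu q beta (x - 1)).

Definition Psi (R : realType) (q beta x : R) : R :=
  2^-1 * (G q beta x + G q^-1 beta x).

Definition C_B (R : realType) : set (R -> R) :=
  [set f | continuous f /\ bounded_fun f].

Definition C_U (R : realType) : set (R -> R) :=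
  [set f | unif_continuous f].

(* Extended-real valued: the supremum is [+oo] when the oscillations of [f]
   at scale [theta] are unbounded. *)
Definition modulus (R : realType) (f : R -> R) (theta : R) : \bar R :=
  ereal_sup [set `|f p.1 - f p.2|%:E | p in [set p : R * R | `|p.1 - p.2| <= theta]].

(* Real-valued Lebesgue integrals; the outer one converges absolutely for
   [f] in [C_B] or [C_U] because [Psi] decays exponentially and a uniformly
   continuous function grows at most linearly. *)
Definition Bstar (R : realType) (q beta : R) (n : nat) (f : R -> R) (x : R) : R :=
  n%:R * \int[lebesgue_measure]_(v in [set: R])
    ((\int[lebesgue_measure]_(h in `[0, n%:R^-1]) f (h + v / n%:R)) *
     Psi q beta (n%:R * x - v)).

(* Main.v *)
(* Translating the integration variable v by n(y - x) turns Bstar f y into an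
   integral with the same weight Psi(n x - v) as Bstar f x, where f has been
   replaced by f(. + y - x). So, if f varies by at most M between points at
   distance |x - y|, then |Bstar f x - Bstar f y| <= M * \int Psi, and Psi >= 0
   as nu is increasing. Finally \int Psi <= 1: since |nu| <= 1, a primitive L of
   nu is 1-Lipschitz, so the primitive (L(x + 1) - L(x - 1)) / 4 of G takes its
   values in [-1/2, 1/2]. *)
Require Import Defs.
From HB Require Import structures.
From mathcomp Require Import all_boot all_order all_algebra.
From mathcomp Require Import all_classical all_reals all_analysis.
From mathcomp Require Import measurable_realfun ring lra.
Set Implicit Arguments.
Unset Strict Implicit.
Unset Printing Implicit Defensive.
Import Order.TTheory GRing.Theory Num.Theory.
Import numFieldNormedType.Exports.
Local Open Scope classical_set_scope.
Local Open Scope ring_scope.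

(** * Real-valued integrals and the default value 0 *)

Lemma Rintegral_nonintegrable d (T : measurableType d) (R : realType)
    (mu : {measure set T -> \bar R}) (D : set T) (u : T -> R) :
  measurable D -> measurable_fun D u -> ~ mu.-integrable D (EFin \o u) ->
  \int[mu]_(x in D) u x = 0.
Proof.
move=> mD mfu nint; rewrite /Rintegral.
have [fin|] := boolP ((\int[mu]_(x in D) (u x)%:E)%E \is a fin_num); last first.
  (* [fine] sends both infinities to 0. *)
  by rewrite fin_numEn => /orP[|] /eqP ->.
(* A finite integral of a measurable function forces that of its absolute value to be finite, which
   contradicts non-integrability. *)
exfalso; apply: nint; apply/integrableP; split; first exact/measurable_EFinP.
by rewrite integral_fin_num_abs.
Qed.

(* No integrability of [u] and [w] is required: they are integrable together,
   and otherwise both integrals are [0] by convention. This is why neither the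
   growth of [f] nor the moments of [Psi] have to be estimated. *)
Lemma Rintegral_dist_le d (T : measurableType d) (R : realType)
    (mu : {measure set T -> \bar R}) (D : set T) (u w k : T -> R) :
  measurable D -> measurable_fun D u -> measurable_fun D w ->
  mu.-integrable D (EFin \o k) -> (forall x, D x -> `|u x - w x| <= k x) ->
  `|\int[mu]_(x in D) u x - \int[mu]_(x in D) w x| <= \int[mu]_(x in D) k x.
Proof.
move=> mD mfu mw ik uwk.
have iB : mu.-integrable D (EFin \o (fun x => u x - w x)).
  apply: le_integrable ik => //.
    by apply/measurable_EFinP; exact: measurable_funB.
  move=> x Dx; rewrite /= lee_fin (le_trans (uwk x Dx))//; exact: ler_norm.
have [iu|niu] := pselect (mu.-integrable D (EFin \o u)).
  have iw : mu.-integrable D (EFin \o w).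
    have := integrableB mD iu iB; apply: eq_integrable => // x _ /=.
    by rewrite -EFinB opprB addrC subrK.
  rewrite -RintegralB//; apply: (le_trans (le_normr_Rintegral _ _)) => //.
  apply: le_Rintegral => //; exact: integrable_norm.
have niw : ~ mu.-integrable D (EFin \o w).
  move=> iw; apply: niu.
  have := integrableD mD iB iw; apply: eq_integrable => // x _ /=.
  by rewrite -EFinD subrK.
rewrite (@Rintegral_nonintegrable _ _ _ _ _ u)//.
rewrite (@Rintegral_nonintegrable _ _ _ _ _ w)// subrr normr0.
by apply: Rintegral_ge0 => x Dx; rewrite (le_trans _ (uwk x Dx)).
Qed.

(** * Translations and continuity of moving integrals *)

Lemma continuous_shift (R : realType) (f : R -> R) (c : R) :
  continuous f -> continuous (fun x => f (x + c)).
Proof.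
move=> cf x; apply: (@continuous_comp R R R (fun y => y + c) f x).
  by apply: cvgD; [exact: cvg_id|exact: cvg_cst].
exact: cf.
Qed.

Lemma continuous_reflect (R : realType) (f : R -> R) (c : R) :
  continuous f -> continuous (fun x => f (c - x)).
Proof.
move=> cf x; apply: (@continuous_comp R R R (fun y => c - y) f x).
  by apply: cvgB; [exact: cvg_cst|exact: cvg_id].
exact: cf.
Qed.

(** Change of variables along the increasing map [y + d], whose derivative is 1. *)
Lemma ge0_integral_addr (R : realType) (u : R -> R) (d : R) :
  continuous u -> (forall x, 0 <= u x) ->
  (\int[lebesgue_measure]_x (u (x + d)%R)%:E =
   \int[lebesgue_measure]_x (u x)%:E)%E.
Proof.
move=> cu u0.
have D x : is_derive x (1 : R) (fun y : R => y + d) 1.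
  by apply: is_derive_eq; rewrite addr0.
have dE : (fun y : R => y + d)^`()%classic = cst 1.
  by apply/funext => x; rewrite derive1E derive_val.
rewrite [RHS](@increasing_ge0_integration_by_substitutionT _ (fun y => y + d))//.
- by apply: eq_integral => x _; rewrite dE /= !fctE mulr1.
- by move=> x y; rewrite ltrD2r.
- by rewrite dE; exact: cst_continuous.
- by rewrite dE; exact: is_cvg_cst.
- by rewrite dE; exact: is_cvg_cst.
- exact: cvg_addrr_Ny.
- exact: cvg_addrr.
Qed.

(** Positive and negative parts are translated separately, so the extended integrals already agree
    before [fine] is applied, even when they are infinite. *)
Lemma Rintegral_addr (R : realType) (u : R -> R) (d : R) : continuous u ->
  \int[lebesgue_measure]_x (u (x + d)) = \int[lebesgue_measure]_x (u x).
Proof.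
move=> cu; rewrite /Rintegral; congr fine; rewrite integralE [RHS]integralE.
rewrite !(funerpos, funerneg (fun x => u (x + d)), funerneg u).
congr (_ - _)%E.
- apply: (@ge0_integral_addr _ u^\+ d) => [x|x]; last exact: funrpos_ge0.
  exact: (@continuous_max _ _ u (cst 0) x (cu x) (@cst_continuous _ _ _ x)).
- apply: (@ge0_integral_addr _ u^\- d) => [x|x]; last exact: funrneg_ge0.
  exact: (@continuous_max _ _ (\- u) (cst 0) x (continuousN (cu x))
    (@cst_continuous _ _ _ x)).
Qed.

(** Dominated convergence: for [s] within 1 of [a], the points [h + s] stay in one compact interval,
    on which [f] is bounded. *)
Lemma continuous_moving_integral (R : realType) (f : R -> R) (r : R) :
  continuous f ->
  continuous (fun s => \int[lebesgue_measure]_(h in `[0, r]) f (h + s)).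
Proof.
move=> cf a.
have [M [_ Mf]] : bounded_set (f @` `[a - 1, r + (a + 1)]).
  apply: compact_bounded; apply: continuous_compact.
    exact: continuous_subspaceT.
  exact: segment_compact.
have aI : a \in `]a - 1, a + 1[%classic.
  by rewrite inE /= in_itv/= ltrBlDr ltrDl ltr01.
(* [bounded_set] makes every number above [M] a bound, hence the dominating constant [M + 1]. *)
apply: (@continuity_under_integral R _ _ lebesgue_measure
  (fun s h => f (h + s)) `[0, r]%classic _ (a - 1) (a + 1) _ _ (cst (M + 1))) => //.
- move=> s _; apply: continuous_compact_integrable.
    exact: segment_compact.
  by apply: continuous_subspaceT; exact: continuous_shift.
- apply: aeW => h _ s _; apply: (@continuous_comp R R R (fun s => h + s) f s).
    by apply: cvgD; [exact: cvg_cst|exact: cvg_id].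
  exact: cf.
- apply: continuous_compact_integrable.
    exact: segment_compact.
  by apply: continuous_subspaceT; exact: cst_continuous.
- move=> s /=; rewrite in_itv/= => /andP[as_ sa].
  apply: aeW => h /=; rewrite in_itv/= => /andP[h0 hr].
  apply: (Mf (M + 1)); first by rewrite ltrDl.
  exists (h + s) => //=; rewrite in_itv/= (lerD hr (ltW sa)) andbT.
  by rewrite (le_trans (ltW as_))// lerDr.
Qed.

(** * The function [nu] and its primitive *)

Lemma nu_den_gt0 (R : realType) (q beta x : R) :
  0 < q -> 0 < 1 + q * expR (- beta * x).
Proof. by move=> q0; rewrite addr_gt0// mulr_gt0// expR_gt0. Qed.

(** With [x] occurring only once, monotonicity can be read off factor by factor. *)
Lemma nuE (R : realType) (q beta x : R) : 0 < q ->
  nu q beta x = 2 / (1 + q * expR (- beta * x)) - 1.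
Proof.
move=> q0; have := nu_den_gt0 beta x q0; rewrite /nu => /lt0r_neq0 h.
by field.
Qed.

Lemma continuous_nu (R : realType) (q beta : R) : 0 < q ->
  continuous (nu q beta).
Proof.
move=> q0 x; have h := lt0r_neq0 (nu_den_gt0 beta x q0).
have cE : {for x, continuous (fun y : R => q * expR (- beta * y))}.
  apply: cvgM; first exact: cvg_cst.
  apply: (@continuous_comp _ _ _ (fun y => - beta * y) (@expR R)).
    exact: mulrl_continuous.
  exact: continuous_expR.
apply: cvgM.
  by apply: cvgB => //; exact: cvg_cst.
apply: cvgV => //.
by apply: cvgD => //; exact: cvg_cst.
Qed.

Lemma ler_nu (R : realType) (q beta : R) : 0 < q -> 0 < beta ->
  {homo nu q beta : x y / x <= y}.
Proof.
move=> q0 b0 x y xy; rewrite !nuE// lerD2r ler_pM2l//.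
rewrite lef_pV2 ?posrE ?nu_den_gt0// lerD2l ler_pM2l// ler_expR.
by rewrite !mulNr lerN2 ler_pM2l.
Qed.

Lemma normr_nu_le1 (R : realType) (q beta x : R) : 0 < q ->
  `|nu q beta x| <= 1.
Proof.
move=> q0; have d0 := nu_den_gt0 beta x q0.
have e0 : 0 <= q * expR (- beta * x) by rewrite mulr_ge0 ?expR_ge0// ltW.
rewrite /nu normrM normfV (gtr0_norm d0) ler_pdivrMr// mul1r.
by apply: (le_trans (ler_normB _ _)); rewrite normr1 ger0_norm.
Qed.

(* Comes from [nu = 1 - 2 e / (1 + e)] with [e := q * expR (- beta * x)]. *)
Definition nu_primitive (R : realType) (q beta x : R) : R :=
  x + 2 / beta * ln (1 + q * expR (- beta * x)).

Lemma is_derive_nu_primitive (R : realType) (q beta x : R) :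
  0 < q -> 0 < beta -> is_derive x 1 (nu_primitive q beta) (nu q beta x).
Proof.
move=> q0 b0; have d0 := nu_den_gt0 beta x q0.
have De : is_derive x (1 : R) (fun y : R => 1 + q * expR (- beta * y))
    (q * (expR (- beta * x) * - beta)).
  have De' : is_derive x (1 : R) (fun y => expR (- beta * y))
      (expR (- beta * x) * - beta).
    apply: (@is_derive1_comp R (@expR R) (fun y => - beta * y)).
    by apply: is_derive_eq; rewrite ?scaler0 ?addr0 /GRing.scale/= mulr1.
  by apply: is_derive_eq; rewrite /GRing.scale/=; ring.
have Dl : is_derive x (1 : R) (fun y : R => ln (1 + q * expR (- beta * y)))
    ((1 + q * expR (- beta * x))^-1 * (q * (expR (- beta * x) * - beta))).
  apply: (@is_derive1_comp R (@ln R) (fun y => 1 + q * expR (- beta * y))).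
  exact: is_derive1_ln.
apply: is_derive_eq.
rewrite nuE// /GRing.scale/=.
have h := lt0r_neq0 d0; have hb := lt0r_neq0 b0.
by field; rewrite h hb.
Qed.

Lemma nu_primitive_lipschitz (R : realType) (q beta x y : R) :
  0 < q -> 0 < beta ->
  `|nu_primitive q beta x - nu_primitive q beta y| <= `|x - y|.
Proof.
move=> q0 b0; wlog yx : x y / y <= x.
  by move=> H; case: (leP y x) => [|/ltW] /H //; rewrite distrC (distrC x).
have D z := is_derive_nu_primitive z q0 b0.
have [|z _ ->] := MVT_segment yx (fun z _ => D z).
  apply: derivable_within_continuous => z _; exact: ex_derive.
by rewrite normrM ler_piMl// normr_nu_le1.
Qed.

(** * The kernels [G] and [Psi] and their total mass *)

Definition G_primitive (R : realType) (q beta x : R) : R :=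
  4^-1 * (nu_primitive q beta (x + 1) - nu_primitive q beta (x - 1)).

Lemma is_derive_G_primitive (R : realType) (q beta x : R) :
  0 < q -> 0 < beta -> is_derive x 1 (G_primitive q beta) (G q beta x).
Proof.
move=> q0 b0.
have D c : is_derive x (1 : R) (fun y : R => nu_primitive q beta (y + c))
    (nu q beta (x + c)).
  rewrite -[nu _ _ _]mulr1.
  apply: (@is_derive1_comp R (nu_primitive q beta) (fun y => y + c)).
    exact: is_derive_nu_primitive.
  by apply: is_derive_eq; rewrite addr0.
have D1 := D 1; have D2 := D (-1).
by apply: is_derive_eq.
Qed.

Lemma normr_G_primitive_le (R : realType) (q beta x : R) :
  0 < q -> 0 < beta -> `|G_primitive q beta x| <= 2^-1.
Proof.
move=> q0 b0; rewrite normrM ger0_norm//.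
have := nu_primitive_lipschitz (x + 1) (x - 1) q0 b0.
(* The Lipschitz bound over a distance of 2, times [4^-1], gives [2^-1]. *)
rewrite [x + 1 - _](_ : _ = 2); last by ring.
rewrite (ger0_norm (_ : 0 <= 2))// => h; lra.
Qed.

Lemma continuous_G (R : realType) (q beta : R) : 0 < q ->
  continuous (G q beta).
Proof.
move=> q0 x.
have cnu c : continuous (fun y => nu q beta (y + c)).
  exact/continuous_shift/continuous_nu.
apply: cvgM; first exact: cvg_cst.
by apply: cvgB; [exact: cnu|exact: (cnu (-1))].
Qed.

Lemma G_ge0 (R : realType) (q beta x : R) : 0 < q -> 0 < beta ->
  0 <= G q beta x.
Proof.
move=> q0 b0; rewrite mulr_ge0// subr_ge0 ler_nu//.
by rewrite lerD2l; lra.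
Qed.

Lemma continuous_Psi (R : realType) (q beta : R) : 0 < q ->
  continuous (Psi q beta).
Proof.
move=> q0 x; apply: cvgM; first exact: cvg_cst.
by apply: cvgD; apply: continuous_G; rewrite ?invr_gt0.
Qed.

Lemma Psi_ge0 (R : realType) (q beta x : R) : 0 < q -> 0 < beta ->
  0 <= Psi q beta x.
Proof.
by move=> q0 b0; rewrite mulr_ge0// addr_ge0// G_ge0// invr_gt0.
Qed.

(** The integral over the line is the limit of those over [[-i, i]], and each of these is the
    increment [F i - F (- i)], at most [l]. *)
Lemma ge0_integralT_le_primitive (R : realType) (g F : R -> R) (l : R) :
  continuous g -> (forall x, 0 <= g x) ->
  (forall x : R, is_derive x 1 F (g x)) -> (forall x y, F x - F y <= l) ->
  (\int[lebesgue_measure]_x (g x)%:E <= l%:E)%E.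
Proof.
move=> cg g0 D Fl.
have mg : measurable_fun setT (EFin \o g).
  by apply/measurable_EFinP; exact: continuous_measurable_fun.
have dF x : derivable F x 1 by exact: ex_derive.
have cF : continuous F.
  by move=> x; exact/differentiable_continuous/derivable1_diffP/dF.
have ndI : nondecreasing_seq (fun i : nat => `[- i%:R, i%:R]%classic : set R).
  move=> i j ij; rewrite subsetEset.
  by apply: subset_itv; rewrite bnd_simp ?lerN2 ler_nat.
have := @ge0_nondecreasing_set_cvg_integral _ (measurableTypeR R) R
  (fun i : nat => `[- i%:R, i%:R]%classic : set R) (EFin \o g)
  lebesgue_measure ndI.
rewrite (bigcup_itvT true false) => H.
have {}H := H (fun=> measurable_itv _) (fun=> measurable_funTS mg)
  (fun i x _ => g0 x).
rewrite -(cvg_lim _ H)//; apply: lime_le.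
  by apply/cvg_ex; eexists; exact: H.
apply: nearW => -[|n].
  (* For [i = 0] the interval is a point, outside the scope of the fundamental theorem; here
     [0 = F 0 - F 0 <= l]. *)
  rewrite /= oppr0 set_itv1 integral_set1 lee_fin.
  by rewrite (le_trans _ (Fl 0 0))// subrr.
rewrite (@continuous_FTC2 _ g F).
- by rewrite -EFinB lee_fin.
- by rewrite -subr_gt0 opprK addr_gt0.
- exact: continuous_subspaceT.
- split => [x _|//|]; first exact: dF.
  + by apply: cvg_at_right_filter; exact: cF.
  + by apply: cvg_at_left_filter; exact: cF.
- by move=> x _; rewrite derive1E derive_val.
Qed.

Lemma integral_Psi_le1 (R : realType) (q beta c : R) : 0 < q -> 0 < beta ->
  (\int[lebesgue_measure]_v (Psi q beta (c - v))%:E <= 1)%E.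
Proof.
move=> q0 b0; have qV0 : 0 < q^-1 by rewrite invr_gt0.
(* The outer minus sign compensates the reflection [c - v] in the derivative. *)
pose F v :=
  - (2^-1 * (G_primitive q beta (c - v) + G_primitive q^-1 beta (c - v))).
apply: (@ge0_integralT_le_primitive _ (fun v => Psi q beta (c - v)) F 1).
- exact/continuous_reflect/continuous_Psi.
- by move=> x; exact: Psi_ge0.
- move=> x; have D r : 0 < r ->
      is_derive x (1 : R) (fun v => G_primitive r beta (c - v))
        (- G r beta (c - x)).
    move=> r0; have Dc : is_derive x (1 : R) (fun v : R => c - v) (- 1).
      by apply: is_derive_eq; rewrite add0r mul1r.
    have DG := @is_derive_G_primitive R r beta (c - x) r0 b0.
    have := @is_derive1_comp R (G_primitive r beta) (fun v => c - v)
      x _ _ DG Dc.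
    by rewrite mulrN1.
  have D1 := D _ q0; have D2 := D _ qV0.
  by apply: is_derive_eq; rewrite /Psi /GRing.scale/=; ring.
- move=> x y; rewrite /F.
  (* Four values of [G_primitive], each at most [2^-1] in absolute value and of weight [2^-1], bound
     the increment of [F] by 1. *)
  have h := normr_G_primitive_le.
  have := (h R q beta (c - x) q0 b0, h R q beta (c - y) q0 b0).
  have := (h R _ beta (c - x) qV0 b0, h R _ beta (c - y) qV0 b0).
  rewrite !ler_norml => -[/andP[? ?] /andP[? ?]] [/andP[? ?] /andP[? ?]].
  by lra.
Qed.

(** * Oscillation of the inner and outer integrals *)

Lemma moving_integral_dist_le (R : realType) (f : R -> R) (r s t M : R) :
  0 <= r -> continuous f -> (forall h, `|f (h + s) - f (h + t)| <= M) ->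
  `|\int[lebesgue_measure]_(h in `[0, r]) f (h + s) -
    \int[lebesgue_measure]_(h in `[0, r]) f (h + t)| <= M * r.
Proof.
move=> r0 cf fM.
have -> : M * r = \int[lebesgue_measure]_(h in `[0, r]) (cst M h) :> R.
  rewrite /cst Rintegral_cst//; congr (_ * _).
  rewrite [X in fine X]lebesgue_measure_itv/= lte_fin oppr0 adde0.
  (* The measure of the interval is given by cases on [0 < r]; in the other case [r = 0]. *)
  by case: ltP => // r_le0; apply/eqP; rewrite eq_le r0 r_le0.
have mf c : measurable_fun `[0, r] (fun h => f (h + c)).
  apply: measurable_funTS; apply: continuous_measurable_fun.
  exact: continuous_shift.
apply: Rintegral_dist_le => //; [exact: mf|exact: mf|].
apply: continuous_compact_integrable; first exact: segment_compact.
by apply: continuous_subspaceT; exact: cst_continuous.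
Qed.

(** The integrands differ by at most [M * P v], which is integrable with integral at most [M]. *)
Lemma weighted_integral_shift_dist_le (R : realType) (A P : R -> R) (d M : R) :
  continuous A -> continuous P -> (forall v, 0 <= P v) ->
  (\int[lebesgue_measure]_v (P v)%:E <= 1)%E ->
  (forall v, `|A v - A (v + d)| <= M) ->
  `|\int[lebesgue_measure]_v (A v * P v) -
    \int[lebesgue_measure]_v (A (v + d) * P v)| <= M.
Proof.
move=> cA cP P0 P1 AM.
have M0 : 0 <= M by rewrite (le_trans _ (AM 0)).
have mP (u : R -> R) : continuous u ->
    measurable_fun [set: measurableTypeR R] (fun v => u v * P v).
  move=> cu; apply: continuous_measurable_fun => v.
  by apply: cvgM; [exact: cu|exact: cP].
have iP : lebesgue_measure.-integrable [set: measurableTypeR R] (EFin \o P).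
  apply/integrableP; split.
    by apply/measurable_EFinP; exact: continuous_measurable_fun.
  under eq_integral => v _ do rewrite /= ger0_norm//.
  by rewrite (le_lt_trans P1)// ltry.
apply: (@le_trans _ _ (\int[lebesgue_measure]_v (M * P v))).
  apply: (Rintegral_dist_le measurableT).
  - exact: mP.
  - by apply: (mP (fun v => A (v + d))); exact: continuous_shift.
  - exact: (@integrableZl _ _ _ _ _ measurableT M _ iP).
  - move=> v _; rewrite -mulrBl normrM (ger0_norm (P0 v)).
    by rewrite ler_wpM2r.
rewrite (RintegralZl _ measurableT iP) ler_piMr//.
rewrite -lee_fin /Rintegral fineK//.
exact: (integrable_fin_num measurableT iP).
Qed.

Lemma Bstar_dist_le (R : realType) (q beta : R) (n : nat) (f : R -> R)
    (x y M : R) : 0 < q -> 0 < beta -> (0 < n)%N -> continuous f ->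
  (forall s, `|f s - f (s + (y - x))| <= M) ->
  `|Bstar q beta n f x - Bstar q beta n f y| <= M.
Proof.
move=> q0 b0 n0 cf fM.
have n0R : 0 < n%:R :> R by rewrite ltr0n.
have nN0 := lt0r_neq0 n0R.
pose A (v : R) := \int[lebesgue_measure]_(h in `[0, n%:R^-1]) f (h + v / n%:R).
have BE z : Bstar q beta n f z =
    n%:R * \int[lebesgue_measure]_v (A v * Psi q beta (n%:R * z - v)) by [].
rewrite !BE.
have cA : continuous A.
  move=> v; apply: (@continuous_comp R R R (fun v => v / n%:R)
    (fun s => \int[lebesgue_measure]_(h in `[0, n%:R^-1]) f (h + s)) v).
    by apply: cvgM; [exact: cvg_id|exact: cvg_cst].
  exact: continuous_moving_integral.
(* Division by [n] turns the shift of [v] into [y - x]. The length [1/n] of the inner interval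
   yields [M / n], which the prefactor [n] of [Bstar] will cancel. *)
have AM v : `|A v - A (v + n%:R * (y - x))| <= M / n%:R.
  apply: moving_integral_dist_le => [|//|h]; first by rewrite invr_ge0 ltW.
  rewrite (_ : h + (v + _) / _ = h + v / n%:R + (y - x)); first exact: fM.
  by field.
move: A {BE} cA AM => A cA AM.
have cPsi := @continuous_Psi R q beta q0.
(* Translating only the integral for [y] moves the dependence on [y] from the weight into [A]. *)
rewrite -(@Rintegral_addr _ (fun v => A v * Psi q beta (n%:R * y - v))
  (n%:R * (y - x))); last first.
  move=> v; apply: cvgM; first exact: cA.
  exact: (continuous_reflect cPsi).
have PsiE v : Psi q beta (n%:R * y - (v + n%:R * (y - x))) =
    Psi q beta (n%:R * x - v) by congr Psi; ring.
under [X in _ - _ * X]eq_Rintegral => v _ do rewrite PsiE.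
rewrite -mulrBr normrM (ger0_norm (ltW n0R)) mulrC -ler_pdivlMr//.
apply: (@weighted_integral_shift_dist_le _ A
  (fun v => Psi q beta (n%:R * x - v))) => //.
- exact: continuous_reflect.
- by move=> v; exact: Psi_ge0.
- exact: integral_Psi_le1.
Qed.

(** * Uniform continuity and the modulus *)

Lemma C_UP (R : realType) (f : R -> R) :
  C_U f <-> forall e, 0 < e ->
    exists2 d, 0 < d & forall x y, `|x - y| < d -> `|f x - f y| < e.
Proof.
rewrite /C_U /= unif_continuousP; split=> H e e0; have [d d0 Hd] := H e e0.
- by exists d => // x y; exact: (Hd (x, y)).
- by exists d => // -[x y]; exact: Hd.
Qed.

Lemma C_U_continuous (R : realType) (f : R -> R) : C_U f -> continuous f.
Proof.
move=> /C_UP fU x; apply/cvgrPdist_lt => e /fU[d d0 fd].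
by exists d => // y; exact: fd.
Qed.

Theorem theorem6 (R : realType) (q beta : R) (n : nat)
    (q_gt0 : 0 < q) (beta_gt0 : 0 < beta) (n_gt0 : (0 < n)%N) :
  (forall f : R -> R, (@C_B R `|` @C_U R) f ->
     forall theta : R, 0 < theta ->
       (modulus (Bstar q beta n f) theta <= modulus f theta)%E) /\
  (forall f : R -> R, @C_U R f -> @C_U R (Bstar q beta n f)).
Proof.
(* Both claims follow from this bound, with [M] the modulus in the first and [e / 2] in the
   second. *)
have contraction f x y M : continuous f ->
    (forall s t, `|s - t| <= `|x - y| -> `|f s - f t| <= M) ->
    `|Bstar q beta n f x - Bstar q beta n f y| <= M.
  move=> cf fM; apply: Bstar_dist_le => // s; apply: fM.
  by rewrite opprD addNKr opprB.
split=> [f fCBU theta theta0|f fCU].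
- have cf : continuous f by case: fCBU => [[]//|/C_U_continuous].
  have ub s t : `|s - t| <= theta -> (`|f s - f t|%:E <= modulus f theta)%E.
    by move=> st; apply: ereal_sup_ubound; exists (s, t).
  (* An infinite modulus makes the inequality trivial; otherwise it is a real number that can serve
     as [M]. *)
  have [->|ltyM] := eqVneq (modulus f theta) +oo%E; first exact: leey.
  have finM : modulus f theta \is a fin_num.
    rewrite ge0_fin_numE ?lt_neqAle ?ltyM ?leey//.
    (* The pair [(0, 0)] shows that the modulus is nonnegative, which excludes [-oo]. *)
    by apply: le_trans (ub 0 0 _); rewrite ?lee_fin// subrr normr0 ltW.
  apply: ge_ereal_sup => _ [[x y] /= xyt <-].
  rewrite -(fineK finM) lee_fin; apply: contraction => // s t st.
  by rewrite -lee_fin fineK// ub// (le_trans st).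
- apply/C_UP => e e0; have e20 : 0 < e / 2 by rewrite divr_gt0.
  have [d d0 fd] := (C_UP f).1 fCU _ e20.
  (* The [d] of [f] for [e / 2] serves [Bstar] for [e]: [contraction] gives a non-strict bound, and
     halving restores strictness. *)
  exists d => // x y xyd; apply: (@le_lt_trans _ _ (e / 2)); last by lra.
  apply: contraction; first exact: C_U_continuous.
  by move=> s t st; apply/ltW/fd/(le_lt_trans st).
Qed.
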